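(* The graphon representation property is separably determined; that is, a Banach space $X$ has the graphon representation property if and only if every closed separable subspace of $X$ has the graphon representation property.
   Context: All Banach spaces are real; $[0,1]^S$ ($S$ a finite set) carries Lebesgue measure; $\langle\phi,x\rangle:=\phi(x)$ for $\phi\in X^*$, $x\in X$. An $X$-decorated target graph is a pair $\mathbf G=(G,g)$ where $G$ is a finite graph that is complete and completely looped (every two vertices are adjacent and every vertex has a loop) and $g:E(G)\to X$. An $X^*$-decorated test graph is a pair $\mathbf F=(F,f)$ where $F$ is a finite simple graph (without loops) and $f:E(F)\to X^*$. The homomorphism density is $$t(\mathbf F,\mathbf G)=\frac{1}{|V(G)|^{|V(F)|}}\sum_{\varphi:V(F)\to V(G)}\ \prod_{ij\in E(F)}\langle f(ij),g(\varphi(i)\varphi(j))\rangle,$$ the sum being over all maps $\varphi$. For $1\le p<\infty$ put $\|\mathbf G\|_p=\big(|V(G)|^{-2}\sum_{u,v\in V(G)}\|g(uv)\|_X^p\big)^{1/p}$. An $X$-valued Bochner graphon is a Bochner (strongly) measurable function $W:[0,1]^2\to X$ which is symmetric ($W(x,y)=W(y,x)$ for a.e. $(x,y)$) and satisfies $\|W(\cdot,\cdot)\|_X\in L^p([0,1]^2)$ for every $1\le p<\infty$. Its densities are $$t(\mathbf F,W)=\int_{[0,1]^{V(F)}}\prod_{ij\in E(F)}\langle f(ij),W(x_i,x_j)\rangle\prod_{i\in V(F)}dx_i.$$ A Banach space $X$ has the graphon representation property if: whenever a sequence $(\mathbf G_n)$ of $X$-decorated target graphs satisfies (1) $\sup_n\|\mathbf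 G_n\|_p<\infty$ for every $1\le p<\infty$ and (2) $(t(\mathbf F,\mathbf G_n))_n$ converges for every $X^*$-decorated test graph $\mathbf F$, there is an $X$-valued Bochner graphon $W$ with $t(\mathbf F,\mathbf G_n)\to t(\mathbf F,W)$ for every $X^*$-decorated test graph $\mathbf F$. *)

(* Defs.v *)
From HB Require Import structures.
From mathcomp Require Import all_boot all_order all_algebra.
From mathcomp Require Import all_classical all_reals all_analysis.

Set Implicit Arguments.
Unset Strict Implicit.
Unset Printing Implicit Defensive.

Import Order.TTheory GRing.Theory Num.Theory.
Import numFieldNormedType.Exports.

Local Open Scope classical_set_scope.
Local Open Scope ring_scope.

Section UnitCube.
Context {R : realType}.

(* Lebesgue measure of [0,1], seen as a measure on all of R. *)
Definition unit_lebesgue : set (measurableTypeR R) -> \bar R :=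
  mrestr (@lebesgue_measure R) (measurable_itv `[0%R, 1%R]).

HB.instance Definition _ := Measure.copy unit_lebesgue
  (mrestr (@lebesgue_measure R) (measurable_itv `[0%R, 1%R])).

Let unit_lebesgueT : unit_lebesgue setT = 1%E.
Proof.
rewrite /unit_lebesgue /mrestr setTI lebesgue_measure_itv/= lte_fin ltr01.
by rewrite oppr0 adde0.
Qed.

HB.instance Definition _ :=
  Measure_isProbability.Build _ _ _ unit_lebesgue unit_lebesgueT.

Definition cons_pair n (z : measurableTypeR R * n.-tuple (measurableTypeR R)) :
    n.+1.-tuple (measurableTypeR R) :=
  [tuple of z.1 :: z.2].

Lemma measurable_cons_pair n : measurable_fun setT (@cons_pair n).
Proof. by apply: measurable_cons; [exact: measurable_fst|exact: measurable_snd]. Qed.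

HB.instance Definition _ n :=
  isMeasurableFun.Build _ _ _ _ (@cons_pair n) (@measurable_cons_pair n).

Fixpoint cube (n : nat) : probability (n.-tuple (measurableTypeR R)) R :=
  match n with
  | 0 => \d_[tuple]
  | m.+1 => distribution (unit_lebesgue \x cube m)%E (@cons_pair m)
  end.

Definition square :
    {measure set (measurableTypeR R * measurableTypeR R) -> \bar R} :=
  (unit_lebesgue \x unit_lebesgue)%E.

End UnitCube.

Record closedSubspace (R : realType) (X : normedModType R) := ClosedSubspace {
  subspace_set :> set X;
  subspace0 : subspace_set 0;
  subspaceP : forall (a : R) (u v : X),
    subspace_set u -> subspace_set v -> subspace_set (a *: u + v);
  subspace_closed : closed subspace_set
}.

Section SubspaceNormed.
Context {R : realType} {X : normedModType R} (Y : closedSubspace X).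

Definition subspace_pred : {pred X} := fun x => x \in (Y : set X).

Definition subspace_type := {x : X | subspace_pred x}.

Lemma subspace_submod_closed : GRing.submod_closed subspace_pred.
Proof.
split; first by apply/mem_set; exact: subspace0.
move=> a u v /set_mem Yu /set_mem Yv; apply/mem_set; exact: subspaceP.
Qed.

HB.instance Definition _ := SubChoice.on subspace_type.
HB.instance Definition _ := GRing.SubChoice_isSubLmodule.Build R X
  subspace_pred subspace_type subspace_submod_closed.

Let norm (y : subspace_type) : R := `|val y|.
Let norm_triangle (x y : subspace_type) : norm (x + y) <= norm x + norm y.
Proof. by rewrite /norm raddfD ler_normD. Qed.
Let normZ (l : R) (x : subspace_type) : norm (l *: x) = `|l| * norm x.
Proof. by rewrite /norm linearZ normrZ. Qed.
Let norm_eq0 (x : subspace_type) : norm x = 0 -> x = 0.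
Proof. by move=> /normr0_eq0 x0; apply/val_inj; rewrite x0 raddf0. Qed.

HB.instance Definition _ :=
  Lmodule_isNormed.Build R subspace_type norm_triangle normZ norm_eq0.

Lemma subspace_normE (y : subspace_type) : `|y| = `|val y|.
Proof. by []. Qed.

End SubspaceNormed.

Section SubspaceComplete.
Context {R : realType} {X : completeNormedModType R} (Y : closedSubspace X).

Lemma subspace_complete (F : set_system (subspace_type Y)) :
  ProperFilter F -> cauchy F -> cvg F.
Proof.
move=> FF Fc.
have Gc : cauchy (val @ F : set_system X).
  apply/cauchy_ballP => e e0.
  have /cauchy_ballP /(_ e e0) H := Fc.
  rewrite near_map2; apply: (@filterS _ (filter_prod F F) _ _ _ _ H).
  move=> -[x y] /=.
  by rewrite -!ball_normE /ball_ /= subspace_normE raddfB.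
have /cauchy_cvg Gl := Gc.
have Yl : (Y : set X) (lim (val @ F)).
  apply: (closed_cvg (F := F) (u_ := val) _ (@subspace_closed _ _ Y) _ _ Gl).
  by near=> x; apply: set_mem; exact: (valP x).
apply/cvg_ex; exists (exist (subspace_pred Y) _ (mem_set Yl)).
apply/cvgrPdist_lt => e e0.
have /cvgrPdist_lt /(_ e e0) := Gl.
by apply: filterS => x; rewrite subspace_normE raddfB.
Unshelve. all: by end_near. Qed.

HB.instance Definition _ :=
  Uniform_isComplete.Build (subspace_type Y) subspace_complete.

End SubspaceComplete.

Definition separable (T : topologicalType) :=
  exists2 D : set T, countable D & dense D.

Record dual (R : realType) (X : normedModType R) := Dual {
  dual_fun :> {linear X -> R^o};
  dual_continuous : continuous dual_fun
}.

Definition pairing (R : realType) (X : normedModType R)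
  (phi : dual X) (x : X) : R := phi x.

(* All pairs of vertices, loops included, are edges. *)
Record targetGraph (R : realType) (X : normedModType R) := TargetGraph {
  tvertex : finType;
  tvertex_gt0 : (0 < #|tvertex|)%N;
  tdeco : tvertex -> tvertex -> X;
  tdeco_sym : forall u v, tdeco u v = tdeco v u
}.

(* Only the values of [deco] on edges matter. *)
Record testGraph (R : realType) (X : normedModType R) := TestGraph {
  vertex : finType;
  edge : rel vertex;
  edge_sym : symmetric edge;
  edge_irr : irreflexive edge;
  deco : vertex -> vertex -> dual X;
  deco_sym : forall i j, edge i j -> deco i j = deco j i
}.

Section Densities.
Context {R : realType} {X : normedModType R}.
Implicit Types (F : testGraph X) (G : targetGraph X) (W : R * R -> X).

(* Each edge is listed once, oriented along the enumeration of the vertices. *)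
Definition oriented_edge F (e : vertex F * vertex F) : bool :=
  edge e.1 e.2 && (enum_rank e.1 < enum_rank e.2)%N.

Definition density F G : R :=
  (#|tvertex G|%:R ^+ #|vertex F|)^-1 *
  \sum_(phi : {ffun vertex F -> tvertex G})
    \prod_(e : vertex F * vertex F | oriented_edge e)
      pairing (deco e.1 e.2) (tdeco (phi e.1) (phi e.2)).

Definition target_norm (p : R) G : R :=
  ((#|tvertex G|%:R ^+ 2)^-1 *
   \sum_(u : tvertex G) \sum_(v : tvertex G) `|tdeco u v| `^ p) `^ p^-1.

(* The coordinates of [0,1]^V are indexed through [enum_rank]. *)
Definition graphon_density F W : R :=
  \int[cube #|vertex F|]_x
    \prod_(e : vertex F * vertex F | oriented_edge e)
      pairing (deco e.1 e.2)
        (W (tnth x (enum_rank e.1), tnth x (enum_rank e.2))).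

End Densities.

Definition simple_function d (T : measurableType d) (V : Type) (s : T -> V) :=
  finite_set (range s) /\ forall c : V, measurable (s @^-1` [set c]).

(* With Borel simple functions and an a.e. limit, this is the same notion as
   with Lebesgue measurable ones. *)
Definition strongly_measurable d (T : measurableType d) (R : realType)
    (mu : {measure set T -> \bar R}) (V : normedModType R) (f : T -> V) :=
  exists2 s : nat -> T -> V, (forall n, simple_function (s n)) &
    {ae mu, forall z, s n z @[n --> \oo] --> f z}.

(* [W] is defined on all of R^2; only its restriction to [0,1]^2, which carries
   the measure [square], is relevant. *)
Record bochner_graphon (R : realType) (X : normedModType R) (W : R * R -> X) :=
  BochnerGraphon {
    graphon_measurable : strongly_measurable (@square R) W;
    graphon_sym : {ae (@square R), forall z, W z = W (z.2, z.1)};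
    graphon_norm : forall p : R, 1 <= p ->
      finite_norm (@square R) p%:E (fun z => `|W z|)
  }.

Definition graphon_representation_property
    (R : realType) (X : completeNormedModType R) :=
  forall G : nat -> targetGraph X,
    (forall p : R, 1 <= p -> has_ubound (range (fun n => target_norm p (G n)))) ->
    (forall F : testGraph X, cvgn (fun n => density F (G n))) ->
    exists2 W : R * R -> X, bochner_graphon W &
      forall F : testGraph X,
        density F (G n) @[n --> \oo] --> graphon_density F W.

(* Main.v *)
Require Import Defs.
From HB Require Import structures.
From mathcomp Require Import all_boot all_order all_algebra.
From mathcomp Require Import all_classical all_reals all_analysis.
From mathcomp Require Import measurable_realfun.
From mathcomp Require Import ring lra.

Set Implicit Arguments.
Unset Strict Implicit.
Unset Printing Implicit Defensive.

Import Order.TTheory GRing.Theory Num.Theory.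
Import numFieldNormedType.Exports.

Local Open Scope classical_set_scope.
Local Open Scope ring_scope.

(** If [X] has the property and [Y] is a closed subspace, a sequence of
    [Y]-decorated graphs has a limit [W] with values in [X]; a functional [phi]
    vanishing on [Y] makes every density of the 4-cycle with all edges decorated
    by [phi] vanish, hence also that of [W].  Writing [V = phi o W], this density
    is the integral of the square of [h (a, b) = int_c V (a, c) V (b, c)], so
    [h = 0] a.e.; then [int_c (int_A V (a, c) da)^2] is the integral of [h] over
    [A * A], hence zero, all integrals of [V] over rectangles vanish, and [V = 0]
    a.e.  Applying this to the countably many functionals that separate from [Y]
    the values of simple functions converging to [W] shows that [W] is a.e. in
    [Y], and Hahn-Banach extension of the decorations identifies the densities.

    Conversely, the decorations of a sequence of [X]-decorated graphs span a
    separable closed subspace, and densities only see the restrictions of the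
    functionals to it.

    A graphon here is only a.e. equal to a Borel function, and its densities are
    integrals of possibly non-measurable functions; these still depend only on
    the a.e. class of the integrand. *)

(** * The Hahn-Banach theorem for sublinear majorants *)

Section HahnBanach.
Context {R : realType} {V : lmodType R}.
Variable p : V -> R.
Hypothesis pD : forall x y, p (x + y) <= p x + p y.
Hypothesis pZ : forall t x, 0 < t -> p (t *: x) = t * p x.

(* Linear maps are handled through their graphs; a linear relation below [p]
   is automatically single-valued. *)
Definition dominated_graph (G : set (V * R)) :=
  [/\ G (0, 0),
      forall a x r y s, G (x, r) -> G (y, s) -> G (a *: x + y, a * r + s) &
      forall x r, G (x, r) -> r <= p x].

Let p0 : p 0 = 0.
Proof. by have := @pZ 2 0 ltac:(by []); rewrite scaler0; lra. Qed.

(** The difference of two values at [x] is a value at 0, hence at most [p 0 = 0]; exchanging the two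
    values gives equality. *)
Lemma dominated_graph_inj G x r s :
  dominated_graph G -> G (x, r) -> G (x, s) -> r = s.
Proof.
move=> [G0 GL Gp] xr xs.
have H a b : G (x, a) -> G (x, b) -> a <= b.
  move=> xa xb; have := Gp _ _ (GL (-1) _ _ _ _ xb xa).
  by rewrite scaleN1r addNr p0; lra.
by apply/eqP; rewrite eq_le !H.
Qed.

(** A value [c] at [x0] is admissible as soon as [r - p (u - x0) <= c <= p (v + x0) - s] for all
    [(u, r)] and [(v, s)] in [G]. Subadditivity puts every left side below every right side, so the
    supremum of the left sides works. *)
Lemma dominated_graph_extend G x0 : dominated_graph G ->
  exists G', [/\ dominated_graph G', G `<=` G' & exists r, G' (x0, r)].
Proof.
move=> [G0 GL Gp].
have key u r v s : G (u, r) -> G (v, s) -> r - p (u - x0) <= p (v + x0) - s.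
  move=> ur vs; have := Gp _ _ (GL 1 _ _ _ _ ur vs).
  rewrite scale1r mul1r => h; have := pD (u - x0) (v + x0).
  by rewrite addrACA addNr addr0; lra.
pose E := [set t | exists u r, G (u, r) /\ t = r - p (u - x0)].
have E0 : E !=set0 by exists (0 - p (0 - x0)), 0, 0.
have Eub : has_ubound E.
  by exists (p (0 + x0) - 0) => _ [u [r [ur ->]]]; exact: key.
pose c := sup E.
have c1 u r : G (u, r) -> r - p (u - x0) <= c.
  by move=> ur; apply: ub_le_sup => //; exists u, r.
have c2 v s : G (v, s) -> c <= p (v + x0) - s.
  by move=> vs; apply: ge_sup => // _ [u [r [ur ->]]]; exact: key.
have GZ a u r : G (u, r) -> G (a *: u, a * r).
  by move=> ur; have := GL a _ _ _ _ ur G0; rewrite !addr0.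
exists [set z | exists u r a, G (u, r) /\ z = (u + a *: x0, r + a * c)].
split; [split|..].
- by exists 0, 0, 0; split => //; rewrite scale0r mul0r !addr0.
- move=> a x r y s [u [ru [b [ub [-> ->]]]]] [v [rv [d [vd [-> ->]]]]].
  exists (a *: u + v), (a * ru + rv), (a * b + d); split; first exact: GL.
  congr pair; last by ring.
  by rewrite scalerDr scalerDl scalerA addrACA.
- move=> x r [u [ru [b [ub [-> ->]]]]].
  (* The lower bound on [c] at [(- b)^-1 *: u] settles negative [b], the upper bound at [b^-1 *: u]
     positive [b], after multiplication by the absolute value of [b]. *)
  have [b0|b0|->] := ltgtP b 0; last by rewrite scale0r mul0r !addr0; exact: Gp.
  + have nb : 0 < - b by rewrite oppr_gt0.
    have := c1 _ _ (GZ (- b)^-1 _ _ ub).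
    rewrite -(ler_pM2l nb) mulrBr mulrA divff ?gt_eqF// mul1r -pZ//.
    rewrite scalerBr scalerA divff ?gt_eqF// scale1r scaleNr opprK.
    by lra.
  + have := c2 _ _ (GZ b^-1 _ _ ub).
    rewrite -(ler_pM2l b0) mulrBr mulrA divff ?gt_eqF// mul1r -pZ//.
    rewrite scalerDr scalerA divff ?gt_eqF// scale1r.
    by lra.
- by move=> [u r] ur; exists u, r, 0; split => //; rewrite scale0r mul0r !addr0.
- by exists c, 0, 0, 1; split => //; rewrite scale1r mul1r !add0r.
Qed.

Lemma hahn_banach G : dominated_graph G ->
  exists f : {linear V -> R^o},
    (forall x, f x <= p x) /\ (forall x r, G (x, r) -> f x = r).
Proof.
move=> Gd.
(* Zorn's lemma runs over sets [A] with [A] united to [G] dominated, so that the empty chain, whose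
   union is empty, also has an upper bound. *)
have [|A [Ad Amax]] := @Zorn_bigcup _ (fun A => dominated_graph (A `|` G)).
  move=> F FP Ftot; split; first by right; case: Gd.
  - move=> a x r y s.
    have sub A : F A -> A `|` G `<=` \bigcup_(X in F) X `|` G.
      by move=> FA z [zA|zG]; [left; exists A|right].
    have inA A : F A -> (A `|` G) (x, r) -> (A `|` G) (y, s) ->
        (\bigcup_(X in F) X `|` G) (a *: x + y, a * r + s).
      move=> FA xr ys; apply: (sub _ FA).
      by have [_ L _] := FP _ FA; exact: L.
    move=> [[A FA Ax]|Gx] [[B FB By]|Gy].
    + have [AB|BA] := Ftot _ _ FA FB.
      * by apply: (inA _ FB); left => //; exact: AB.
      * by apply: (inA _ FA); left => //; exact: BA.
    + by apply: (inA _ FA); [left|right].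
    + by apply: (inA _ FB); [right|left].
    + by right; have [_ L _] := Gd; exact: L.
  - move=> x r [[A FA Ax]|Gx]; last by have [_ _ H] := Gd; exact: H.
    by have [_ _ H] := FP _ FA; apply: H; left.
set M := A `|` G in Ad.
(* Were [x] outside the domain of the maximal relation, its extension to [x] would be strictly
   larger. *)
have Mtot x : exists r, M (x, r).
  have [M' [M'd MM' [r M'r]]] := dominated_graph_extend x Ad.
  exists r; apply: contrapT => nM; apply: (Amax M').
    rewrite properEneq; split; last by move=> z Az; apply: MM'; left.
    by apply/eqP => AM'; apply: nM; left; rewrite AM'.
  suff -> : M' `|` G = M' by [].
  by apply/setUidPl => z Gz; apply: MM'; right.
have [f fM] := choice Mtot.
have flin : linear (f : V -> R^o).
  move=> a x y; apply: (dominated_graph_inj Ad (fM _)).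
  by have [_ L _] := Ad; exact: L.
pose lf := GRing.isLinear.Build R V R^o *:%R f flin.
pose g : {linear V -> R^o} := HB.pack f lf.
exists g; split=> x.
  by have [_ _ H] := Ad; apply: H; exact: fM.
by move=> r Gr; apply: (dominated_graph_inj Ad (fM x)); right.
Qed.

End HahnBanach.

(** * Continuity and boundedness of functionals *)

Section DualMaps.
Context {R : realType} {X : normedModType R}.

Lemma bounded_continuous_functional (f : {linear X -> R^o}) (C : R) :
  (forall x, `|f x| <= C * `|x|) -> continuous f.
Proof.
move=> fC; apply: bounded_linear_continuous; apply/linear_boundedP.
near=> r => x; apply: (le_trans (fC x)); rewrite ler_wpM2r//.
Unshelve. all: by end_near. Qed.

Lemma dual_bounded (phi : dual X) :
  exists2 C : R, 0 <= C & forall x, `|phi x| <= C * `|x|.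
Proof.
have : bounded_near phi (nbhs (0 : X)).
  by apply: continuous_linear_bounded; exact: (@dual_continuous _ _ phi).
move=> /linear_boundedP [M [Mr HM]].
exists (`|M| + 1); first by rewrite addr_ge0.
by apply: HM; rewrite (le_lt_trans (ler_norm M))// ltrDl.
Qed.

Lemma functional_le_norm (f : {linear X -> R^o}) (C : R) :
  (forall x, f x <= C * `|x|) -> forall x, `|f x| <= C * `|x|.
Proof.
move=> H x; rewrite ler_norml; apply/andP; split => //.
by have := H (- x); rewrite linearN normrN; lra.
Qed.

End DualMaps.

(** * Restriction, extension and separation of functionals for a closed subspace *)

Section SubspaceDuality.
Context {R : realType} {X : normedModType R} (Y : closedSubspace X).

Lemma val_continuous : continuous (val : subspace_type Y -> X).
Proof.
apply: (@bounded_linear_continuous _ _ _ (val : {linear subspace_type Y -> X})).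
apply/linear_boundedP; near=> r => y /=.
by rewrite -subspace_normE ler_peMl.
Unshelve. all: by end_near. Qed.

Definition dual_restrict (phi : dual X) : dual (subspace_type Y) :=
  @Dual _ _ (phi \o (val : {linear subspace_type Y -> X}))
    (fun y => continuous_comp (@val_continuous y)
                              (@dual_continuous _ _ phi (val y))).

(** Hahn-Banach for the graph of [psi], with a multiple of the norm as majorant. *)
Lemma dual_extend_subproof (psi : dual (subspace_type Y)) :
  exists phi : dual X, forall y, phi (val y) = psi y.
Proof.
have [C C0 psiC] := dual_bounded psi.
have pD (x y : X) : C * `|x + y| <= C * `|x| + C * `|y|.
  by rewrite -mulrDr ler_wpM2l// ler_normD.
have pZ t (x : X) : 0 < t -> C * `|t *: x| = t * (C * `|x|).
  by move=> t0; rewrite normrZ gtr0_norm// mulrCA.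
pose G := [set z : X * R | exists y, z = (val y, psi y)].
have [|f [fp fG]] := @hahn_banach R X _ pD pZ G.
  split.
  - by exists 0; rewrite !raddf0.
  - move=> a _ _ _ _ [y [-> ->]] [z [-> ->]]; exists (a *: y + z).
    by rewrite !linearP.
  - by move=> _ _ [y [-> ->]]; rewrite -subspace_normE (le_trans (ler_norm _)).
have fc := bounded_continuous_functional (functional_le_norm fp).
by exists (Dual fc) => y; apply: fG; exists y.
Qed.

Definition dual_extend (psi : dual (subspace_type Y)) : dual X :=
  projT1 (cid (dual_extend_subproof psi)).

Lemma dual_extendE psi y : dual_extend psi (val y) = psi y.
Proof. exact: projT2 (cid (dual_extend_subproof psi)) y. Qed.

Let distances (x : X) := [set `|x - y| | y in (Y : set X)].

Let dist x := inf (distances x).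

Let has_inf_distances x : has_inf (distances x).
Proof.
split; first by exists `|x - 0|, 0 => //; exact: subspace0.
by exists 0 => _ [y _ <-].
Qed.

Let dist_le x y : (Y : set X) y -> dist x <= `|x - y|.
Proof.
by move=> Yy; apply: ge_inf; [case: (has_inf_distances x)|exists y].
Qed.

Let dist_lt x e : 0 < e -> exists2 y, (Y : set X) y & `|x - y| < dist x + e.
Proof.
by move=> e0; have [_ [y Yy <-] ?] := inf_adherent e0 (has_inf_distances x);
  exists y.
Qed.

Let subspaceZ a y : (Y : set X) y -> (Y : set X) (a *: y).
Proof.
by move=> Yy; rewrite -[_ *: _]addr0; apply: subspaceP => //; exact: subspace0.
Qed.

Let subspaceD x y : (Y : set X) x -> (Y : set X) y -> (Y : set X) (x + y).
Proof. by move=> Yx Yy; rewrite -[x]scale1r; exact: subspaceP. Qed.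

Let distD x y : dist (x + y) <= dist x + dist y.
Proof.
apply/ler_addgt0Pr => e e0; have e2 : 0 < e / 2 by rewrite divr_gt0.
have [u Yu xu] := dist_lt x e2; have [v Yv yv] := dist_lt y e2.
apply: (le_trans (dist_le (x + y) (subspaceD Yu Yv))).
by rewrite opprD addrACA (le_trans (ler_normD _ _))//; lra.
Qed.

Let distZ_le t x : 0 < t -> dist (t *: x) <= t * dist x.
Proof.
move=> t0; apply/ler_addgt0Pr => e e0.
have [u Yu xu] := dist_lt x (divr_gt0 e0 t0).
apply: (le_trans (dist_le (t *: x) (subspaceZ t Yu))).
rewrite -scalerBr normrZ gtr0_norm//.
move: xu; rewrite -(ltr_pM2l t0) mulrDr mulrCA divff ?gt_eqF// mulr1.
exact: ltW.
Qed.

Let distZ t x : 0 < t -> dist (t *: x) = t * dist x.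
Proof.
move=> t0; apply/eqP; rewrite eq_le distZ_le//=.
have ti : 0 < t^-1 by rewrite invr_gt0.
have := distZ_le (t *: x) ti; rewrite scalerA mulVf ?gt_eqF// scale1r.
by rewrite -(ler_pM2l t0) mulrA divff ?gt_eqF// mul1r.
Qed.

Let dist_ge0 x : 0 <= dist x.
Proof.
by apply: lb_le_inf; [case: (has_inf_distances x)|move=> _ [y _ <-]].
Qed.

(** Hahn-Banach with the distance to [Y] as majorant, prescribing [t * dist x] at [t *: x]. The
    majorant vanishes at [y] and [- y] for [y] in [Y], which forces [phi y = 0]; it is below the
    norm because 0 lies in [Y]. The last clause holds because [phi x] is the distance from [x] to
    [Y]. *)
Lemma separating_functional x : exists phi : dual X,
  [/\ forall y, (Y : set X) y -> phi y = 0,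
      forall z, phi z <= `|z| &
      forall e, 0 < e -> exists2 y, (Y : set X) y & `|x - y| < phi x + e].
Proof.
pose G := [set z : X * R | exists t, z = (t *: x, t * dist x)].
have distY y : (Y : set X) y -> dist y = 0.
  move=> Yy; apply/eqP; rewrite eq_le dist_ge0 andbT.
  by have := dist_le y Yy; rewrite subrr normr0.
have [|f [fp fG]] := @hahn_banach R X _ distD distZ G.
  split.
  - by exists 0; rewrite scale0r mul0r.
  - move=> a _ _ _ _ [t [-> ->]] [s [-> ->]]; exists (a * t + s).
    by rewrite scalerDl scalerA mulrDl mulrA.
  - move=> _ _ [t [-> ->]]; have [t0|t0|->] := ltgtP t 0.
    + by rewrite (le_trans _ (dist_ge0 _))// nmulr_rle0.
    + by rewrite distZ.
    + by rewrite mul0r.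
have f1 z : f z <= 1 * `|z|.
  rewrite mul1r (le_trans (fp z))//.
  by have := dist_le z (subspace0 Y); rewrite subr0.
have fc := bounded_continuous_functional (functional_le_norm f1).
exists (Dual fc); split.
- move=> y Yy; apply/eqP; rewrite eq_le /=.
  have := fp y; rewrite distY// => -> /=.
  have := fp (- y); rewrite linearN distY; first by lra.
  by rewrite -scaleN1r; exact: subspaceZ.
- by move=> z; have := f1 z; rewrite mul1r.
- have -> : Dual fc x = dist x by apply: fG; exists 1; rewrite scale1r mul1r.
  exact: dist_lt.
Qed.

(** Serves to move values of simple functions into [Y]. The slack [e] is there because the distance
    may not be attained. *)
Lemma near_best_approximation x e : 0 < e ->
  exists y : subspace_type Y,
    forall z, (Y : set X) z -> `|x - val y| <= `|x - z| + e.
Proof.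
move=> e0; have [y Yy xy] := dist_lt x e0.
exists (exist (subspace_pred Y) y (mem_set Yy)) => z Yz /=.
by rewrite (le_trans (ltW xy))// lerD2r dist_le.
Qed.

End SubspaceDuality.

(** * Integrals of possibly non-measurable functions *)

Section NonmeasurableIntegral.
Import HBNNSimple.
Context {d} {T : measurableType d} {R : realType}.
Variable mu : {measure set T -> \bar R}.
Local Open Scope ereal_scope.

(* The integral of an arbitrary nonnegative function is a supremum over the
   simple functions below it, so measurability plays no role. *)
Lemma ae_le_integral_nonmeasurable (f g : T -> \bar R) :
  (forall x, 0 <= f x) -> (forall x, 0 <= g x) ->
  {ae mu, forall x, f x <= g x} -> \int[mu]_x f x <= \int[mu]_x g x.
Proof.
move=> f0 g0 [N [mN N0 NP]].
rewrite (ge0_integralTE _ f0) (ge0_integralTE _ g0).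
apply: ge_ereal_sup => _ [h /= hf <-].
have mNC : measurable (~` N) by exact: measurableC.
(* Cutting [h] off on the null set keeps its integral and puts it below [g] everywhere. *)
pose h' : {nnsfun T >-> R} := mul_nnsfun h (indic_nnsfun R mNC).
have -> : sintegral mu h = sintegral mu h'.
  rewrite -!integralT_nnsfun; apply: ge0_ae_eq_integral => //.
  - exact/measurable_EFinP.
  - exact/measurable_EFinP.
  - by move=> x _; rewrite lee_fin.
  - by move=> x _; rewrite lee_fin.
  exists N; split=> // x /= nhx; apply: contrapT => nNx; apply: nhx => _.
  by rewrite mindicE mem_set// mulr1.
apply: ereal_sup_ubound; exists h' => // x /=.
rewrite mindicE; have [xN|xN] := pselect (N x).
  by rewrite memNset ?mulr0//; apply.
rewrite mem_set// mulr1 (le_trans (hf x))//.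
by apply: contrapT => nfg; apply: xN; exact: NP.
Qed.

Lemma ae_eq_integral_nonmeasurable (f g : T -> \bar R) :
  {ae mu, forall x, f x = g x} -> \int[mu]_x f x = \int[mu]_x g x.
Proof.
move=> fg; rewrite integralE [RHS]integralE.
have H (u v : T -> \bar R) : (forall x, 0 <= u x) -> (forall x, 0 <= v x) ->
    {ae mu, forall x, u x = v x} -> \int[mu]_x u x = \int[mu]_x v x.
  move=> u0 v0 uv; apply/eqP; rewrite eq_le; apply/andP.
  by split; apply: ae_le_integral_nonmeasurable => //; apply: filterS uv => x ->.
congr (_ - _); apply: H => //; apply: filterS fg => x fgx;
  by rewrite ?funepos.unlock ?funeneg.unlock fgx.
Qed.

Lemma ae_eq_finite_norm (p : R) (f g : T -> R) :
  {ae mu, forall x, f x = g x} ->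
  finite_norm mu p%:E f -> finite_norm mu p%:E g.
Proof.
move=> fg; rewrite /finite_norm unlock.
rewrite (@ae_eq_integral_nonmeasurable _ (fun x => `|(EFin \o g) x| `^ p))//.
by apply: filterS fg => x /= ->.
Qed.

End NonmeasurableIntegral.

Lemma ae_eq_Rintegral d (T : measurableType d) (R : realType)
    (mu : {measure set T -> \bar R}) (f g : T -> R) :
  {ae mu, forall x, f x = g x} ->
  \int[mu]_x f x = \int[mu]_x g x.
Proof.
move=> fg; congr fine; apply: ae_eq_integral_nonmeasurable.
by apply: filterS fg => x ->.
Qed.

Lemma integral_prob_cst d (T : measurableType d) (R : realType)
    (P : probability T R) (r : \bar R) : (\int[P]__ r = r)%E.
Proof.
have -> : (\int[P]__ r = r * P setT)%E by rewrite integral_cst.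
by rewrite probability_setT mule1.
Qed.

(** * Marginals of the cube in one and two coordinates *)

Section CubeMarginals.
Context {R : realType}.
Local Notation P := (@unit_lebesgue R).
Local Notation RT := (measurableTypeR R).
Local Open Scope ereal_scope.

Lemma tnth_cons_pair0 n (a : RT) (t : n.-tuple RT) :
  tnth (cons_pair (a, t)) ord0 = a.
Proof. by []. Qed.

Lemma tnth_cons_pairS n (a : RT) (t : n.-tuple RT) (i : 'I_n) :
  tnth (cons_pair (a, t)) (lift ord0 i) = tnth t i.
Proof. exact: tnthS. Qed.

Lemma cubeS n (A : set (n.+1.-tuple RT)) : measurable A ->
  cube n.+1 A = \int[P]_a cube n [set t | A (cons_pair (a, t))].
Proof.
move=> mA; rewrite /= /distribution /pushforward /product_measure1 /=.
apply: eq_integral => a _ /=; congr (cube n _).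
by apply/seteqP; split => t; rewrite /xsection /= inE.
Qed.

Lemma cube_coord n (i : 'I_n) (B : set RT) : measurable B ->
  cube n [set t | B (tnth t i)] = P B.
Proof.
move=> mB; elim: n i => [[]//|n IHn] i.
have mi (m : nat) (j : 'I_m) : measurable [set t : m.-tuple RT | B (tnth t j)].
  by rewrite -[X in measurable X]setTI; exact: measurable_tnth.
rewrite cubeS//.
have [j ->|->] := unliftP ord0 i.
  transitivity (\int[P]_a P B); last exact: integral_prob_cst.
  apply: eq_integral => a _; rewrite -(IHn j); congr (cube n _).
  by apply/funext => t; rewrite /mkset tnth_cons_pairS.
transitivity (\int[P]_a cube n [set t | B a]).
  by apply: eq_integral.
transitivity (\int[P]_a (\1_B a)%:E); last by rewrite integral_indic// setIT.
apply: eq_integral => a _.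
rewrite indicE; have [aB|aB] := boolP (a \in B).
  rewrite [X in cube n X](_ : _ = setT) ?probability_setT//.
  by apply/seteqP; split => // t _ /=; exact: set_mem.
rewrite [X in cube n X](_ : _ = set0) ?measure0//.
by apply/seteqP; split => // t /= /mem_set; rewrite (negbTE aB).
Qed.

Lemma measurable_coord_pair n (i j : 'I_n) :
  measurable_fun setT (fun t : n.-tuple RT => (tnth t i, tnth t j)).
Proof. by apply: measurable_fun_pair; exact: measurable_tnth. Qed.

(** Induction on [n]: if [i] is not the first coordinate, the first one is integrated out. If it is,
    fixing its value [a] leaves the one-coordinate marginal of the section of [N] at [a]. Increasing
    indices suffice, as [oriented_edge] lists edges that way. *)
Lemma cube_coord_pair n (i j : 'I_n) (N : set (RT * RT)) :
  (i < j)%N -> measurable N ->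
  cube n [set t | N (tnth t i, tnth t j)] = square N.
Proof.
move=> ij mN; elim: n i j ij => [[]//|n IHn] i j ij.
have mij (m : nat) (k l : 'I_m) :
    measurable [set t : m.-tuple RT | N (tnth t k, tnth t l)].
  by rewrite -[X in measurable X]setTI; exact: measurable_coord_pair.
rewrite cubeS//; move: ij; have [j' ->|->//] := unliftP ord0 j.
have [i' ->|->] := unliftP ord0 i => ij.
  transitivity (\int[P]_a square N); last exact: integral_prob_cst.
  apply: eq_integral => a _; rewrite -(IHn _ _ ij); congr (cube n _).
  by apply/funext => t; rewrite /mkset !tnth_cons_pairS.
apply: eq_integral => a _ /=.
rewrite -(cube_coord j' (measurable_xsection a mN)).
congr (cube n _); apply/funext => t.
by rewrite /mkset tnth_cons_pairS /xsection/= inE.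
Qed.

(** Lets a.e. properties of a graphon be used at each edge under the density integral. *)
Lemma ae_cube_coord_pair n (i j : 'I_n) (Q : RT * RT -> Prop) : (i < j)%N ->
  {ae @square R, forall z, Q z} -> {ae cube n, forall t, Q (tnth t i, tnth t j)}.
Proof.
move=> ij [N [mN N0 NQ]].
exists [set t | N (tnth t i, tnth t j)]; split.
- by rewrite -[X in measurable X]setTI; exact: measurable_coord_pair.
- by rewrite cube_coord_pair.
- by move=> t /= nQ; exact: NQ.
Qed.

End CubeMarginals.

(** * Squares of inner integrals, by doubling a variable *)

Section Doubling.
Context {d d'} {S : measurableType d} {T : measurableType d'} {R : realType}.
Variables (mS : {sigma_finite_measure set S -> \bar R}) (P : probability T R).
Local Open Scope ereal_scope.

Lemma integrable_swap d1 d2 (T1 : measurableType d1) (T2 : measurableType d2)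
    (m1 : {sigma_finite_measure set T1 -> \bar R})
    (m2 : {sigma_finite_measure set T2 -> \bar R}) (f : T1 * T2 -> \bar R) :
  (m1 \x m2).-integrable setT f ->
  (m2 \x m1).-integrable setT (fun z => f (z.2, z.1)).
Proof.
move=> fi; have mf := measurable_int _ fi.
apply/integrable12ltyP; first exact: (measurableT_comp mf (measurable_fun_pair measurable_snd measurable_fst)).
by have := (integrable21ltyP _ _ mf).1 fi.
Qed.

Lemma integral_prod_fst (f : T -> \bar R) : measurable_fun setT f ->
  (forall x, 0 <= f x) -> \int[P \x P]_z f z.1 = \int[P]_x f x.
Proof.
move=> mf f0; rewrite fubini_tonelli1//; last exact: measurableT_comp.
by apply: eq_integral => x _; exact: (integral_prob_cst P (f x)).
Qed.

Lemma integral_prod_snd (f : T -> \bar R) : measurable_fun setT f ->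
  (forall x, 0 <= f x) -> \int[P \x P]_z f z.2 = \int[P]_x f x.
Proof.
move=> mf f0; rewrite fubini_tonelli1//; last exact: measurableT_comp.
exact: (integral_prob_cst P (\int[P]_x f x)).
Qed.

(* The cast selects the probability structure of the product, from which its
   sigma-finiteness is inferred. *)
Local Notation PP := ((P \x P)%E : probability (T * T)%type R).

Let fstpair (z : S * (T * T)) : S * T := (z.1, z.2.1).
Let sndpair (z : S * (T * T)) : S * T := (z.1, z.2.2).

Let measurable_fstpair : measurable_fun setT fstpair.
Proof.
apply: measurable_fun_pair; first exact: measurable_fst.
by apply: measurableT_comp; [exact: measurable_fst|exact: measurable_snd].
Qed.

Let measurable_sndpair : measurable_fun setT sndpair.
Proof.
apply: measurable_fun_pair; first exact: measurable_fst.
by apply: measurableT_comp; [exact: measurable_snd|exact: measurable_snd].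
Qed.

Let integrable_fstpair (f : S * T -> \bar R) : (mS \x P).-integrable setT f ->
  (mS \x PP).-integrable setT (f \o fstpair).
Proof.
move=> fi; have mf := measurable_int _ fi.
apply/integrable12ltyP; first exact: measurableT_comp.
rewrite (le_lt_trans _ ((integrable12ltyP _ _ mf).1 fi))//.
rewrite le_eqVlt; apply/orP; left; apply/eqP; apply: eq_integral => s _.
rewrite (integral_prod_fst (f := fun t => `|f (s, t)|))//.
by apply: measurableT_comp => //; exact: (measurableT_comp mf (pair1_measurable s)).
Qed.

Let integrable_sndpair (f : S * T -> \bar R) : (mS \x P).-integrable setT f ->
  (mS \x PP).-integrable setT (f \o sndpair).
Proof.
move=> fi; have mf := measurable_int _ fi.
apply/integrable12ltyP; first exact: measurableT_comp.
rewrite (le_lt_trans _ ((integrable12ltyP _ _ mf).1 fi))//.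
rewrite le_eqVlt; apply/orP; left; apply/eqP; apply: eq_integral => s _.
rewrite (integral_prod_snd (f := fun t => `|f (s, t)|))//.
by apply: measurableT_comp => //; exact: (measurableT_comp mf (pair1_measurable s)).
Qed.

Variable K : S * T -> R.
Hypothesis mK : measurable_fun setT K.
Hypothesis K2 : (mS \x P).-integrable setT (fun z => (K z ^+ 2)%:E).

(** The product is dominated by the sum of the two squares, and each square stays integrable because
    the extra variable ranges over a probability space. *)
Lemma integrable_doubling :
  (mS \x PP).-integrable setT
    (fun z => (K (z.1, z.2.1) * K (z.1, z.2.2))%:E).
Proof.
apply: (@le_integrable _ _ _ _ _ measurableT _
  (((fun z => (K z ^+ 2)%:E) \o fstpair) \+ ((fun z => (K z ^+ 2)%:E) \o sndpair))).
- apply/measurable_EFinP; apply: measurable_funM.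
    exact: (measurableT_comp mK measurable_fstpair).
  exact: (measurableT_comp mK measurable_sndpair).
- move=> z _ /=; rewrite lee_fin ler_norml ger0_norm ?addr_ge0 ?sqr_ge0//.
  rewrite /fstpair /sndpair; set x := K _; set y := K _.
  by apply/andP; split; nra.
- by apply: integrableD => //; [exact: integrable_fstpair|exact: integrable_sndpair].
Qed.

(** By Fubini the double integral is the integral over [s] of the square of [c s], the integral of
    [K (s, t)] in [t]; a nonnegative function with zero integral vanishes a.e. *)
Lemma doubling_eq0 :
  \int[mS \x PP]_z (K (z.1, z.2.1) * K (z.1, z.2.2))%:E = 0 ->
  {ae mS, forall s, \int[P]_t (K (s, t))%:E = 0}.
Proof.
move=> I0.
have KKi := integrable_doubling.
have mK1 s : measurable_fun setT (fun t => K (s, t)).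
  exact: (measurableT_comp mK (pair1_measurable s)).
pose c s := \int[P]_t (K (s, t))%:E.
have ae1 := ae_integrable1 K2.
have ae2 := ae_integrable1 KKi.
have cE : {ae mS, forall s, \int[P \x P]_z (K (s, z.1) * K (s, z.2))%:E = c s ^+ 2
    /\ c s \is a fin_num}.
  apply: filterS2 ae1 ae2 => s i1 i2.
  (* Integrability of [K (s, t)] comes from that of its square through the bound
     [1 + K (s, t) ^+ 2]. *)
  have iK : P.-integrable setT (fun t => (K (s, t))%:E).
    apply: (@le_integrable _ _ _ _ _ measurableT _
      (cst 1%:E \+ (fun t => (K (s, t) ^+ 2)%:E))).
    - exact/measurable_EFinP.
    - move=> t _ /=; rewrite lee_fin ler_norml ger0_norm ?addr_ge0 ?sqr_ge0//.
      by apply/andP; split; nra.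
    - by apply: integrableD => //; exact: finite_measure_integrable_cst.
  have cf : c s \is a fin_num by exact: integrable_fin_num.
  split => //; rewrite -(integral12_prod_meas1 i2) /fubini_F /=.
  under eq_integral do under eq_integral do rewrite EFinM.
  under eq_integral do rewrite integralZl//.
  rewrite -/(c s) -(fineK cf).
  by rewrite integralZr// -/(c s) -[X in X * _](fineK cf).
pose F := fubini_F PP (fun z => (K (z.1, z.2.1) * K (z.1, z.2.2))%:E).
have Fi : mS.-integrable setT F := integrable_fubini_F KKi.
have Fc : {ae mS, forall s, F s = c s ^+ 2 /\ c s \is a fin_num} := cE.
have F0 : ae_eq mS setT F (abse \o F).
  by apply: filterS Fc => s [Fs _] _; rewrite /comp Fs gee0_abs// sqre_ge0.
have : \int[mS]_s `|F s| = 0.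
  rewrite -[RHS]I0 -(integral12_prod_meas1 KKi).
  apply: ae_eq_integral => //; [|exact: measurable_int Fi|].
    by apply: measurableT_comp => //; exact: measurable_int Fi.
  by apply: filterS F0 => s H _; rewrite [RHS]H.
move/(ae_eq_integral_abs _ measurableT (measurable_int _ Fi)).1.
apply: filterS2 Fc => s [Fs cf] /(_ I); rewrite Fs => /eqP.
by rewrite expe_eq0 => /andP[_ /eqP].
Qed.

End Doubling.

(** * Functions whose integrals over rectangles vanish *)

Section RectangleIntegrals.
Context {d d'} {S : measurableType d} {T : measurableType d'} {R : realType}.
Variable m : {measure set (S * T) -> \bar R}.
Local Open Scope ereal_scope.

(** The measurable sets over which [f] integrates to 0 form a Dynkin system containing the
    rectangles, which are stable under intersection and generate the product sigma-algebra. *)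
Lemma rectangle_integrals_eq0 (f : S * T -> R) :
  m.-integrable setT (EFin \o f) ->
  (forall A B, measurable A -> measurable B ->
     \int[m]_z (f z * (\1_A z.1 * \1_B z.2))%:E = 0) ->
  {ae m, forall z, f z = 0%R}.
Proof.
move=> fi fAB.
have mf := measurable_int _ fi.
pose H := [set E : set (S * T) | measurable E /\ \int[m]_(z in E) (f z)%:E = 0].
have H_rect A B : measurable A -> measurable B -> H (A `*` B).
  move=> mA mB; split; first exact: measurableX.
  rewrite integral_mkcond -[RHS](fAB A B mA mB); apply: eq_integral => z _.
  rewrite patchE !indicE in_setX.
  by case: (_ \in A); case: (_ \in B); rewrite /= ?(mulr1, mul0r, mulr0).
have HT : H setT by rewrite -setXTT; exact: H_rect.
have Hdynkin : dynkin H.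
  split => //.
  - move=> E [mE E0]; have mCE := measurableC mE; split => //.
    have [_] := HT; rewrite -(setUv E) integral_setU//.
    + by rewrite E0 add0e.
    + by rewrite setUv.
    + by apply/disj_setPS; rewrite setICr.
  - move=> F tF HF; have mF n : measurable (F n) by case: (HF n).
    split; first exact: bigcupT_measurable.
    rewrite integral_bigcup//.
      by rewrite eseries0// => n _ _; case: (HF n).
    by apply: integrableS fi => //; exact: bigcupT_measurable.
have HE E : measurable E -> H E.
  rewrite measurable_prod_measurableType => mE.
  have Hlambda := (dynkin_lambda_system H).1 Hdynkin.
  apply: (lambda_system_subset _ Hlambda _ _ mE) => //.
  - move=> _ _ [A mA [B mB <-]] [A' mA' [B' mB' <-]].
    exists (A `&` A'); first exact: measurableI.
    by exists (B `&` B'); [exact: measurableI|rewrite setXI].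
  - by move=> _ [A mA [B mB <-]]; exact: H_rect.
have : ae_eq m setT (EFin \o f) (cst 0).
  apply: integral_ae_eq => // E _ mE.
  by rewrite integral0; case: (HE E mE).
by apply: filterS => z /(_ I) [].
Qed.

End RectangleIntegrals.

(** * Vanishing of the 4-cycle integral *)

Section FourCycle.
Context {d} {T : measurableType d} {R : realType} (P : probability T R).
Local Notation PP := ((P \x P)%E : probability (T * T)%type R).
Local Open Scope ereal_scope.

Variable V : T * T -> R.
Hypothesis mV : measurable_fun setT V.
Hypothesis V4 : (P \x P).-integrable setT (fun z => (V z ^+ 4)%:E).

Let mV12 d1 (U : measurableType d1) (p q : U -> T) :
  measurable_fun setT p -> measurable_fun setT q ->
  measurable_fun setT (fun u => V (p u, q u)).
Proof.
by move=> mp mq; exact: (measurableT_comp mV (measurable_fun_pair mp mq)).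
Qed.

(** Integrating out the last variable gives the function h of the overview. *)
Let codegree (z : (T * T) * T) : R := (V (z.1.1, z.2) * V (z.1.2, z.2))%R.

Let m11 : measurable_fun setT (fun z : (T * T) * T => z.1.1).
Proof. exact: (measurableT_comp measurable_fst measurable_fst). Qed.

Let m12 : measurable_fun setT (fun z : (T * T) * T => z.1.2).
Proof. exact: (measurableT_comp measurable_snd measurable_fst). Qed.

Let measurable_codegree : measurable_fun setT codegree.
Proof. by apply: measurable_funM; apply: mV12. Qed.

(** The square of [codegree] is itself a doubling, of [V ^+ 2] with the common variable [c] as base
    point, so fourth moments of [V] are enough. *)
Let integrable_codegree2 :
  (PP \x P).-integrable setT (fun z => (codegree z ^+ 2)%:E).
Proof.
have mV2 : measurable_fun setT (fun z : T * T => V (z.2, z.1) ^+ 2)%R.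
  by apply: measurable_funX; exact: mV12.
have V22 : (P \x P).-integrable setT (fun z => ((V (z.2, z.1) ^+ 2) ^+ 2)%:E).
  apply: eq_integrable (integrable_swap V4) => // z _ /=.
  by rewrite -exprM.
have := integrable_swap (integrable_doubling mV2 V22).
by apply: eq_integrable => // z _ /=; rewrite /codegree exprMn.
Qed.

Lemma integrable_four_cycle : (PP \x PP).-integrable setT (fun z =>
  (V (z.1.1, z.2.1) * V (z.1.2, z.2.1) *
   (V (z.1.1, z.2.2) * V (z.1.2, z.2.2)))%:E).
Proof. exact: (integrable_doubling measurable_codegree integrable_codegree2). Qed.

Let integrable_le_V4 (f : T * T -> R) : measurable_fun setT f ->
  (forall z, `|f z| <= 1 + V z ^+ 4)%R ->
  (P \x P).-integrable setT (EFin \o f).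
Proof.
move=> mf fV; apply: (@le_integrable _ _ _ _ _ measurableT _
  (cst 1%:E \+ (fun z => (V z ^+ 4)%:E))).
- exact/measurable_EFinP.
- move=> z _ /=; rewrite lee_fin [leRHS]ger0_norm//.
  by rewrite addr_ge0 ?exprn_even_ge0.
- apply: integrableD => //.
  exact: (finite_measure_integrable_cst (PP : {finite_measure set _ -> \bar R}%R)).
Qed.

Lemma four_cycle_eq0 :
  \int[PP \x PP]_z (V (z.1.1, z.2.1) * V (z.1.2, z.2.1) *
     (V (z.1.1, z.2.2) * V (z.1.2, z.2.2)))%:E = 0 ->
  {ae P \x P, forall z, V z = 0%R}.
Proof.
move=> I0.
(* First doubling: the base point is the pair [(a, b)], the doubled variable is [c]. *)
have h0 : {ae PP, forall s, \int[P]_c (codegree (s, c))%:E = 0} :=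
  doubling_eq0 measurable_codegree integrable_codegree2 I0.
have indic01 (C : set T) x : (\1_C x = 0 :> R \/ \1_C x = 1 :> R)%R.
  by rewrite indicE; case: (x \in C); [right|left].
have absind (C : set T) x (r : R) : (`|r * \1_C x| <= `|r|)%R.
  by case: (indic01 C x) => ->; rewrite ?mulr0 ?mulr1 ?normr0.
(* [1 + x ^+ 4 - x] equals [(x ^+ 2 - 1 / 2) ^+ 2 + (x - 1 / 2) ^+ 2 + 1 / 2], and likewise with
   [- x] for [x]. *)
have V01 (x : R) : (`|x| <= 1 + x ^+ 4)%R.
  have := sqr_ge0 (x ^+ 2 - 1 / 2)%R.
  have := sqr_ge0 (x - 1 / 2)%R; have := sqr_ge0 (x + 1 / 2)%R.
  by rewrite ler_norml => *; apply/andP; split; lra.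
have V02 (x : R) : (x ^+ 2 <= 1 + x ^+ 4)%R.
  by have := sqr_ge0 (x ^+ 2 - 1 / 2)%R; lra.
(* Second doubling: the base point is [c], the doubled variable is [a], restricted to [A]. *)
have col0 A : measurable A ->
    {ae P, forall c, \int[P]_a (V (a, c) * \1_A a)%:E = 0}.
  move=> mA; pose M (z : T * T) : R := (V (z.2, z.1) * \1_A z.2)%R.
  have mM : measurable_fun setT M.
    apply: measurable_funM; first exact: mV12.
    exact: (measurableT_comp (measurable_indic mA) measurable_snd).
  have M2 : (P \x P).-integrable setT (fun z => (M z ^+ 2)%:E).
    apply: (integrable_swap (f := fun z => (M (z.2, z.1) ^+ 2)%:E)).
    apply: integrable_le_V4.
      apply: measurable_funX.
      exact: (measurableT_comp mM (measurable_fun_pair measurable_snd measurable_fst)).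
    move=> [a c]; rewrite /M /= normrX -[X in (_ <= X)%R]/(1 + V (a, c) ^+ 4)%R.
    rewrite (le_trans _ (V02 _))// -(real_normK (num_real (V _))).
    by rewrite lerXn2r ?nnegrE.
  have := doubling_eq0 mM M2; apply.
  (* Integrating over [c] first turns the inner integral into [\1_A a * \1_A b] times h, which is 0
     a.e. by [h0]. *)
  rewrite -integral21_prod_meas1; last exact: integrable_doubling.
  rewrite -[RHS](integral0 PP setT); apply: ae_eq_integral_nonmeasurable.
  apply: filterS h0 => -[a b] h; rewrite /fubini_G /M /=.
  have [->|a1] := indic01 A a.
    by under eq_integral do rewrite mulr0 mul0r; rewrite integral0.
  have [->|b1] := indic01 A b.
    by under eq_integral do rewrite !mulr0; rewrite integral0.
  by rewrite -[RHS]h; apply: eq_integral => c _; rewrite a1 b1 !mulr1.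
apply: rectangle_integrals_eq0.
  by apply: integrable_le_V4 => // z; exact: V01.
move=> A B mA mB; rewrite -integral21_prod_meas1.
  rewrite -[RHS](integral0 P setT); apply: ae_eq_integral_nonmeasurable.
  apply: filterS (col0 A mA) => c h; rewrite /fubini_G /=.
  have [->|b1] := indic01 B c.
    by under eq_integral do rewrite !mulr0; rewrite integral0.
  by rewrite -[RHS]h; apply: eq_integral => a _; rewrite b1 mulr1.
apply: integrable_le_V4.
  apply: measurable_funM => //; apply: measurable_funM.
    exact: (measurableT_comp (measurable_indic mA) measurable_fst).
  exact: (measurableT_comp (measurable_indic mB) measurable_snd).
move=> z; rewrite mulrA (le_trans (absind _ _ _))// (le_trans (absind _ _ _))//.
Qed.

End FourCycle.

(** * The four-dimensional cube as a product of two squares *)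

Section CubeFour.
Context {R : realType}.
Local Notation P := (@unit_lebesgue R).
Local Notation RT := (measurableTypeR R).
Local Notation PP := ((P \x P)%E : probability (RT * RT)%type R).
Local Open Scope ereal_scope.

Local Notation o0 := (ord0 : 'I_4).
Local Notation o1 := (lift ord0 ord0 : 'I_4).
Local Notation o2 := (lift ord0 (lift ord0 ord0) : 'I_4).
Local Notation o3 := (lift ord0 (lift ord0 (lift ord0 ord0)) : 'I_4).

Definition split_coords (t : 4.-tuple RT) : (RT * RT) * (RT * RT) :=
  ((tnth t o0, tnth t o1), (tnth t o2, tnth t o3)).

Lemma measurable_split_coords : measurable_fun setT split_coords.
Proof. by apply: measurable_fun_pair; exact: measurable_coord_pair. Qed.

HB.instance Definition _ :=
  isMeasurableFun.Build _ _ _ _ split_coords measurable_split_coords.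

(** Two coordinates are peeled off; the remaining two give the constant factor [PP B] through
    [cube_coord_pair]. *)
Lemma cube_split_coords (A B : set (RT * RT)) : measurable A -> measurable B ->
  cube 4 (split_coords @^-1` (A `*` B)) = PP A * PP B.
Proof.
move=> mA mB.
have mB2 : measurable [set t : 2.-tuple RT | B (tnth t ord0, tnth t (lift ord0 ord0))].
  by rewrite -[X in measurable X]setTI; exact: measurable_coord_pair.
have m4 : measurable (split_coords @^-1` (A `*` B)).
  rewrite -[X in measurable X]setTI; apply: measurable_split_coords => //.
  exact: measurableX.
have split_cons a b (t : 2.-tuple RT) :
    split_coords (cons_pair (a, cons_pair (b, t))) =
    ((a, b), (tnth t ord0, tnth t (lift ord0 ord0))).
  by rewrite /split_coords !tnth_cons_pairS !tnth_cons_pair0.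
rewrite cubeS//.
transitivity (\int[P]_a \int[P]_b ((\1_A (a, b))%:E * PP B)).
  apply: eq_integral => a _; rewrite cubeS; last first.
    rewrite -[X in measurable X]setTI.
    exact: (measurableT_comp (@measurable_cons_pair R 3%N) (pair1_measurable a)).
  apply: eq_integral => b _.
  rewrite indicE; have [abA|abA] := boolP ((a, b) \in A).
    rewrite mul1e; apply: etrans (@cube_coord_pair R 2%N ord0 (lift ord0 ord0) B isT mB).
    congr (cube 2 _); apply/funext => t; rewrite /mkset /preimage /mkset split_cons.
    by apply/propext; split => [[]//|Bt]; split => //; exact: set_mem.
  rewrite mul0e -(measure0 (cube 2)); congr (cube 2 _).
  apply/seteqP; split => // t; rewrite /mkset /preimage /mkset split_cons.
  by move=> [/= /mem_set]; rewrite (negbTE abA).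
have mA1 : measurable_fun setT (fun z => (\1_A z)%:E : \bar R).
  exact/measurable_EFinP/measurable_indic.
have := @fubini_tonelli1 _ _ _ _ R P P (fun z => (\1_A z)%:E * PP B).
rewrite /fubini_F => <-; last 2 first.
- exact: emeasurable_funM.
- by move=> z; rewrite mule_ge0// lee_fin.
rewrite (@ge0_integralZr _ _ _ PP _ measurableT (fun z => (\1_A z)%:E))//.
congr (_ * _); transitivity (PP (A `&` setT)); last by rewrite setIT.
exact: integral_indic.
Qed.

(** The image of [cube 4] agrees with the product measure on rectangles, hence everywhere by
    uniqueness; positive and negative parts are then transported separately. *)
Lemma integral_cube_split_coords (f : (RT * RT) * (RT * RT) -> \bar R) :
  measurable_fun setT f ->
  \int[cube 4]_t f (split_coords t) = \int[PP \x PP]_z f z.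
Proof.
move=> mf.
have E (g : (RT * RT) * (RT * RT) -> \bar R) : measurable_fun setT g ->
    (forall z, 0 <= g z) ->
    \int[cube 4]_t g (split_coords t) = \int[PP \x PP]_z g z.
  move=> mg g0.
  rewrite (eq_measure_integral (pushforward (cube 4) split_coords)).
    by rewrite (ge0_integral_pushforward measurable_split_coords).
  move=> A mA _; have U := @product_measure_unique _ _ _ _ R PP PP
    (pushforward (cube 4) split_coords) cube_split_coords.
  exact: U.
rewrite integralE [RHS]integralE; congr (_ - _); rewrite -E//.
- by apply: eq_integral => t _; rewrite !funepos.unlock.
- exact: measurable_funepos.
- by apply: eq_integral => t _; rewrite !funeneg.unlock.
- exact: measurable_funeneg.
Qed.

End CubeFour.

(** * Strongly measurable functions *)

Section StrongMeasurability.
Context {d} {T : measurableType d} {R : realType} {X : normedModType R}.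
Variable mu : {measure set T -> \bar R}.

(** A finite union of fibres. Since [A] is arbitrary, simple functions stay simple under composition
    with any map. *)
Lemma simple_function_preimage (s : T -> X) (A : set X) :
  simple_function s -> measurable (s @^-1` A).
Proof.
move=> [fs ms]; rewrite (_ : s @^-1` A = \bigcup_(c in range s `&` A) s @^-1` [set c]).
  by apply: fin_bigcup_measurable => [|c _]; [exact: finite_setIl|exact: ms].
by apply/seteqP; split=> [z Az|z [c [_ Ac]] /= ->//]; exists (s z).
Qed.

Lemma ae_measurable_comp (W : T -> X) (g : X -> R) :
  strongly_measurable mu W -> continuous g ->
  exists2 V : T -> R, measurable_fun setT V & {ae mu, forall z, g (W z) = V z}.
Proof.
move=> [s ss [N [mN N0 NW]]] cg.
have mNC : measurable (~` N) by exact: measurableC.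
(* Killing the function on the null set [N] makes the convergence hold everywhere, so that the limit
   is measurable. *)
exists (fun z => g (W z) * \1_(~` N) z).
  apply: (measurable_fun_cvg (h := fun n z => g (s n z) * \1_(~` N) z)).
    move=> n; apply: measurable_funM; last exact: measurable_indic.
    move=> _ B _; rewrite setTI; exact: (simple_function_preimage (g @^-1` B)).
  move=> z _; have [zN|zN] := pselect (N z).
    have zNC : z \in ~` N = false by rewrite memNset//=; apply.
    under eq_cvg do rewrite indicE zNC mulr0.
    by rewrite indicE zNC mulr0; exact: cvg_cst.
  have cW : s n z @[n --> \oo] --> W z.
    by apply: contrapT => nW; apply: zN; exact: NW.
  apply: cvgMl; exact: (cvg_comp (s ^~ z) g cW (cg (W z))).
exists N; split=> // z /= nV; apply: contrapT => zN; apply: nV.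
by rewrite indicE mem_set// mulr1.
Qed.

End StrongMeasurability.

Lemma strongly_measurable_comp d (T : measurableType d) (R : realType)
    (X Z : normedModType R) (mu : {measure set T -> \bar R}) (W : T -> X)
    (h : X -> Z) :
  strongly_measurable mu W -> continuous h -> strongly_measurable mu (h \o W).
Proof.
move=> [s ss sW] ch; exists (fun n => h \o s n).
  move=> n; split.
    by have := finite_image h (proj1 (ss n)); rewrite image_comp.
  by move=> c; exact: (simple_function_preimage (h @^-1` [set c]) (ss n)).
by apply: filterS sW => z sz; exact: (cvg_comp (s ^~ z) h sz (ch (W z))).
Qed.

(** * The 4-cycle as a test graph *)

Section FourCycleTest.
Context {R : realType} {X : normedModType R} (phi : dual X).

(* The 4-cycle as the complete bipartite graph between {0, 1} and {2, 3}. *)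
Definition four_cycle_edge : rel 'I_4 := fun i j => (i < 2)%N (+) (j < 2)%N.

Lemma four_cycle_edge_sym : symmetric four_cycle_edge.
Proof. by move=> i j; rewrite /four_cycle_edge addbC. Qed.

Lemma four_cycle_edge_irr : irreflexive four_cycle_edge.
Proof. by move=> i; rewrite /four_cycle_edge addbb. Qed.

Definition four_cycle : testGraph X :=
  @TestGraph _ _ 'I_4 four_cycle_edge four_cycle_edge_sym four_cycle_edge_irr
    (fun _ _ => phi) (fun _ _ _ => erefl).

Lemma oriented_edge_four_cycle (e : 'I_4 * 'I_4) :
  @oriented_edge _ _ four_cycle e = (e.1 < 2 <= e.2)%N.
Proof.
case: e => i j; rewrite /oriented_edge /= !enum_rank_ord /= /four_cycle_edge.
by case: i => -[|[|[|[|//]]]] ?; case: j => -[|[|[|[|//]]]] ?.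
Qed.

Lemma prod_four_cycle (F : 'I_4 -> 'I_4 -> R) :
  let o0 := ord0 : 'I_4 in let o1 := lift ord0 ord0 : 'I_4 in
  let o2 := lift ord0 (lift ord0 ord0) : 'I_4 in
  let o3 := lift ord0 (lift ord0 (lift ord0 ord0)) : 'I_4 in
  \prod_(e : 'I_4 * 'I_4 | @oriented_edge _ _ four_cycle e) F e.1 e.2 =
  F o0 o2 * F o1 o2 * (F o0 o3 * F o1 o3).
Proof.
rewrite /= (eq_bigl _ _ oriented_edge_four_cycle) big_mkcond/=.
rewrite -(pair_bigA _ (fun i j : 'I_4 => if (i < 2 <= j)%N then F i j else 1))/=.
rewrite !big_ord_recl !big_ord0 /= !mul1r !mulr1.
by rewrite -!mulrA; congr (_ * _); rewrite mulrCA.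
Qed.

Lemma density_four_cycle_eq0 (G : targetGraph X) :
  (forall u v, phi (tdeco (t := G) u v) = 0) -> density four_cycle G = 0.
Proof.
move=> phi0; rewrite /density big1 ?mulr0// => f _.
rewrite (bigD1 (ord0, lift ord0 (lift ord0 ord0)) ) /=.
  by rewrite /pairing phi0 mul0r.
by rewrite oriented_edge_four_cycle.
Qed.

End FourCycleTest.

(** * Graphons with values a.e. in a closed subspace *)

Section GraphonRange.
Context {R : realType} {X : normedModType R}.
Local Notation P := (@unit_lebesgue R).
Local Notation RT := (measurableTypeR R).
Local Notation PP := ((P \x P)%E : probability (RT * RT)%type R).

(** Passes between [cube #|'I_4|], over which [graphon_density] integrates, and [cube 4]. *)
Lemma Rintegral_cube_cast m n (e : m = n) (F : ('I_m -> RT) -> R) :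
  \int[cube n]_x F (fun i => tnth x (cast_ord e i)) =
  \int[cube m]_x F (tnth x).
Proof.
case: n / e; congr (Rintegral _ _ _); apply/funext => x; congr (F _).
by apply/funext => i; rewrite cast_ord_id.
Qed.

Lemma integrable_pow4 (W : RT * RT -> X) (V : RT * RT -> R) :
  bochner_graphon W -> measurable_fun setT V ->
  {ae @square R, forall z, `|V z| <= `|W z|} ->
  (P \x P)%E.-integrable setT (fun z => (V z ^+ 4)%:E).
Proof.
move=> bW mV VW; apply/integrableP; split.
  by apply/measurable_EFinP; exact: measurable_funX.
have := @graphon_norm _ _ _ bW 4 ltac:(by rewrite ler1n).
rewrite /finite_norm unlock => /lty_poweRy; rewrite invr_eq0 pnatr_eq0 => /(_ isT).
apply: le_lt_trans; apply: ae_le_integral_nonmeasurable => //.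
  by move=> z; exact: poweR_ge0.
apply: filterS VW => z VW.
rewrite /= normr_id lee_fin (powR_mulrn 4)//.
by rewrite normrX lerXn2r ?nnegrE.
Qed.

Lemma graphon_four_cycle_eq0 (W : RT * RT -> X) (phi : dual X) :
  bochner_graphon W -> (forall x, `|phi x| <= `|x|) ->
  graphon_density (four_cycle phi) W = 0 ->
  {ae @square R, forall z, phi (W z) = 0}.
Proof.
move=> bW phi1 I0.
have [V mV VE] := ae_measurable_comp (graphon_measurable bW) (@dual_continuous _ _ phi).
have V4 : (P \x P)%E.-integrable setT (fun z => (V z ^+ 4)%:E).
  apply: (integrable_pow4 bW mV); apply: filterS VE => z <-; exact: phi1.
pose FV (z : (RT * RT) * (RT * RT)) : R := V (z.1.1, z.2.1) * V (z.1.2, z.2.1) *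
   (V (z.1.1, z.2.2) * V (z.1.2, z.2.2)).
have FVi := integrable_four_cycle mV V4.
suff : {ae (P \x P)%E, forall z, V z = 0}.
  by apply: filterS2 VE => z -> ->.
apply: (four_cycle_eq0 mV V4).
(* A zero real-valued integral could also come from an infinite one; integrability of the 4-cycle
   product excludes this. *)
rewrite -[LHS](fineK (integrable_fin_num measurableT FVi)).
rewrite -integral_cube_split_coords; last exact: measurable_int FVi.
congr EFin; rewrite -[RHS]I0 /graphon_density.
pose prodW (t : 'I_4 -> RT) : R :=
  \prod_(e : 'I_4 * 'I_4 | @oriented_edge _ _ (four_cycle phi) e)
    phi (W (t e.1, t e.2)).
transitivity (\int[cube 4]_x prodW (tnth x)); last first.
  rewrite -(Rintegral_cube_cast (esym (card_ord 4)) prodW).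
  congr (Rintegral _ _ _); apply/funext => x.
  by apply: eq_bigr => e _; rewrite /pairing !enum_rank_ord.
(* It remains to replace [phi (W _)] by its Borel version [V] along each of the four edges. *)
apply: ae_eq_Rintegral.
have ae2 (i j : 'I_4) : (i < j)%N -> {ae cube 4, forall x,
    phi (W (tnth x i, tnth x j)) = V (tnth x i, tnth x j)}.
  by move=> ij; exact: ae_cube_coord_pair ij VE.
pose o0 : 'I_4 := ord0; pose o1 : 'I_4 := lift ord0 ord0.
pose o2 : 'I_4 := lift ord0 (lift ord0 ord0).
pose o3 : 'I_4 := lift ord0 (lift ord0 (lift ord0 ord0)).
have ae3 : {ae cube 4, forall x,
    phi (W (tnth x o0, tnth x o3)) = V (tnth x o0, tnth x o3) /\
    phi (W (tnth x o1, tnth x o3)) = V (tnth x o1, tnth x o3)}.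
  by apply: filterS2 (ae2 o0 o3 isT) (ae2 o1 o3 isT) => x.
apply: filterS3 (ae2 o0 o2 isT) (ae2 o1 o2 isT) ae3 => x h02 h12 [h03 h13].
rewrite /prodW (prod_four_cycle phi (fun i j => phi (W (tnth x i, tnth x j)))).
by rewrite -/o0 -/o1 -/o2 -/o3 h02 h12 h03 h13.
Qed.

Lemma ae_graphon_in_subspace (Y : closedSubspace X) (W : RT * RT -> X) :
  bochner_graphon W ->
  (forall phi : dual X, (forall y, (Y : set X) y -> phi y = 0) ->
     (forall x, `|phi x| <= `|x|) -> {ae @square R, forall z, phi (W z) = 0}) ->
  {ae @square R, forall z, (Y : set X) (W z)}.
Proof.
move=> bW H; have [s ss sW] := graphon_measurable bW.
pose D := \bigcup_n range (s n).
have /countable_injP[k kinj] : countable D.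
  apply: bigcup_countable => // n _.
  by apply: finite_set_countable; case: (ss n).
have [sep sepP] := choice (@separating_functional _ _ Y).
(* At most one [d] has code [n], so the null sets can be indexed by natural numbers. *)
have ae0 n : {ae @square R, forall z, forall d, D d -> k d = n -> sep d (W z) = 0}.
  have [[d [Dd <-]]|nD] := pselect (exists d, D d /\ k d = n).
    have [sepY sep_le _] := sepP d.
    have sep1 : forall x, `|sep d x| <= `|x|.
      move=> x; rewrite -[`|x|]mul1r; move: x; apply: functional_le_norm => x.
      by rewrite mul1r.
    apply: filterS (H _ sepY sep1) => z h d' Dd' /kinj.
    by rewrite !inE => /(_ Dd' Dd) ->.
  by apply: nearW => z d Dd kd; case: nD; exists d.
have {}ae0 := ae_foralln ae0.
apply: filterS2 ae0 sW => z h sWz.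
rewrite -[subspace_set Y]/(Y : set X); apply: (@subspace_closed _ _ Y).
move=> U /nbhs_ballP[e /= e0 eU].
have e3 : 0 < e / 3 by rewrite divr_gt0.
have /cvgrPdist_lt /(_ _ e3)[n _ /(_ n (leqnn n)) sn] := sWz.
set w := W z in sn eU *; set d := s n z in sn.
have Dd : D d by exists n => //; exists z.
have [_ sep_le /(_ _ e3)[y Yy yd]] := sepP d.
exists y; split => //; apply: eU; rewrite -ball_normE /ball_ /=.
(* As [sep d] vanishes at [w], its value at [d] is at most the norm of [d - w], below [e / 3]. Hence
   [y] is within [2 * e / 3] of [d], and within [e] of [w]. *)
have := sep_le (d - w); rewrite linearB (h _ _ Dd erefl) subr0 distrC => dw.
have := ler_normD (w - d) (d - y); rewrite addrA subrK.
by lra.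
Qed.

End GraphonRange.

Lemma ae_forall_countable d (T : measurableType d) (R : realType)
    (mu : {measure set T -> \bar R}) (I : countType) (Q : I -> T -> Prop) :
  (forall i, {ae mu, forall x, Q i x}) -> {ae mu, forall x, forall i, Q i x}.
Proof.
move=> aeQ.
have := @ae_foralln _ _ _ mu
  (fun n x => if unpickle n is Some i then Q i x else True).
have H n : {ae mu, forall x, if unpickle n is Some i then Q i x else True}.
  by case: unpickle => [i|]; [exact: aeQ|exact: nearW].
move=> /(_ H); apply: filterS => x Qx i.
by have := Qx (pickle i); rewrite pickleK.
Qed.

(** Applied below with [dual_extend] and [dual_restrict] to move decorations between a subspace and
    the whole space. *)
Definition map_test (R : realType) (A B : normedModType R)
    (h : dual A -> dual B) (F : testGraph A) : testGraph B :=
  @TestGraph R B (vertex F) (@edge _ _ F) (@edge_sym _ _ F) (@edge_irr _ _ F)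
    (fun i j => h (deco i j)) (fun i j e => congr1 h (deco_sym e)).

(** * Graphs, graphons and densities in a subspace *)

Section SubspaceGraphs.
Context {R : realType} {X : normedModType R} (Y : closedSubspace X).
Local Notation RT := (measurableTypeR R).

Definition lift_target (G : targetGraph (subspace_type Y)) : targetGraph X :=
  @TargetGraph R X (tvertex G) (tvertex_gt0 G)
    (fun u v => val (tdeco (t := G) u v)) (fun u v => congr1 val (tdeco_sym u v)).

Lemma density_dual_extend (F : testGraph (subspace_type Y)) G :
  density (map_test (@dual_extend _ _ Y) F) (lift_target G) = density F G.
Proof.
congr (_ * _); apply: eq_bigr => f _; apply: eq_bigr => e _.
by rewrite /pairing /= dual_extendE.
Qed.

(** Points outside [Y] go to the default 0; the graphons it is applied to meet them only on a null
    set. *)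
Definition retract (x : X) : subspace_type Y := insubd 0 x.

Lemma retractK x : (Y : set X) x -> val (retract x) = x.
Proof. by move=> /mem_set Yx; exact: insubdK. Qed.

(** The values of [s n] may lie outside [Y], where [retract] is 0, so they are sent to nearly
    closest points of [Y]. As [W z] is in [Y], this moves [s n z] by at most its distance to [W z]
    plus [n.+1%:R^-1]. *)
Lemma strongly_measurable_retract d (T : measurableType d)
    (mu : {measure set T -> \bar R}) (W : T -> X) :
  strongly_measurable mu W -> {ae mu, forall z, (Y : set X) (W z)} ->
  strongly_measurable mu (retract \o W).
Proof.
move=> [s ss sW] WY.
have e0 n : 0 < n.+1%:R^-1 :> R by rewrite invr_gt0.
have [r rP] := choice (fun p : nat * X => near_best_approximation Y p.2 (e0 p.1)).
exists (fun n z => r (n, s n z)).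
  move=> n; split.
    by have := finite_image (fun x => r (n, x)) (proj1 (ss n)); rewrite image_comp.
  by move=> c; exact: (simple_function_preimage ((fun x => r (n, x)) @^-1` [set c])).
apply: filterS2 sW WY => z sz Yz; apply/cvgrPdist_lt => e e_gt0.
have e4 : 0 < e / 4 by rewrite divr_gt0.
have /cvgrPdist_lt/(_ _ e4) near1 := sz.
near=> n.
rewrite subspace_normE raddfB /= retractK//.
have h : `|s n z - val (r (n, s n z))| <= `|s n z - W z| + n.+1%:R^-1.
  exact: rP (n, s n z) _ Yz.
have h1 : `|W z - s n z| < e / 4 by near: n; exact: near1.
have h2 : n.+1%:R^-1 < e / 4 by near: n; exact: near_infty_natSinv_lt (PosNum e4).
have := ler_normD (W z - s n z) (s n z - val (r (n, s n z))).
rewrite addrA subrK => h3; apply: (le_lt_trans h3).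
by rewrite (distrC (s n z) (W z)) in h; set c := n.+1%:R^-1 in h h2; lra.
Unshelve. all: by end_near. Qed.

Lemma bochner_graphon_retract (W : RT * RT -> X) :
  bochner_graphon W -> {ae @square R, forall z, (Y : set X) (W z)} ->
  bochner_graphon (retract \o W).
Proof.
move=> bW WY; split.
- exact: strongly_measurable_retract (graphon_measurable bW) WY.
- have [N [mN N0 NP]] := graphon_sym bW; exists N; split=> // z nz.
  by apply: NP => /= Wz; apply: nz; rewrite /= Wz.
- move=> p p1; apply: ae_eq_finite_norm (graphon_norm bW p1).
  by apply: filterS WY => z Yz; rewrite subspace_normE /= retractK.
Qed.

(** There are finitely many edges, so almost every point of the cube puts the values of [W] at all
    of them in [Y], where [dual_extend] agrees with the given functionals. *)
Lemma graphon_density_retract (F : testGraph (subspace_type Y)) (W : RT * RT -> X) :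
  {ae @square R, forall z, (Y : set X) (W z)} ->
  graphon_density (map_test (@dual_extend _ _ Y) F) W =
  graphon_density F (retract \o W).
Proof.
move=> WY; apply: ae_eq_Rintegral.
have H : {ae cube #|vertex F|, forall x, forall e : vertex F * vertex F,
    oriented_edge e ->
    (Y : set X) (W (tnth x (enum_rank e.1), tnth x (enum_rank e.2)))}.
  apply: ae_forall_countable => e.
  have [/andP[_ lt_e]|] := boolP (oriented_edge e); last by move=> _; exact: nearW.
  by apply: filterS (ae_cube_coord_pair lt_e WY) => x.
apply: filterS H => x Hx; apply: eq_bigr => e oe.
by rewrite /pairing /= -dual_extendE retractK//; exact: Hx.
Qed.

End SubspaceGraphs.

Lemma representation_subspace (R : realType) (X : completeNormedModType R)
    (Y : closedSubspace X) :
  graphon_representation_property X ->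
  graphon_representation_property (subspace_type Y).
Proof.
move=> HX G bG cG.
have [|W bW WG] := HX (fun n => lift_target (G n)) bG.
  (* Testing the lifted graphs with [F] amounts to testing the original ones with the restricted
     functionals. *)
  by move=> F; exact: (cG (map_test (@dual_restrict _ _ Y) F)).
have WY : {ae @square R, forall z, (Y : set X) (W z)}.
  apply: ae_graphon_in_subspace => // phi phiY phi1.
  apply: graphon_four_cycle_eq0 => //.
  (* The density in [W] is the limit of densities that are all 0. *)
  apply: (cvg_unique _ (WG (four_cycle phi))) => //.
  rewrite (_ : (fun n => _) = (fun=> 0)); first exact: cvg_cst.
  apply/funext => n; apply: density_four_cycle_eq0 => u v.
  by apply: phiY; exact: set_mem (valP _).
exists (retract Y \o W); first exact: bochner_graphon_retract.
move=> F; rewrite -graphon_density_retract//.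
have := WG (map_test (@dual_extend _ _ Y) F).
by under eq_cvg do rewrite density_dual_extend.
Qed.

(** * The closed separable subspace spanned by countably many vectors *)

Section CountableSpan.
Context {R : realType} {X : normedModType R} {I : countType} (v : I -> X).

Definition rational_span : set X :=
  range (fun s : seq (rat * I) => \sum_(c <- s) (ratr c.1 : R) *: v c.2).

Lemma rational_span_countable : countable rational_span.
Proof. exact: sub_countable (card_image_le _ _) (countableP _). Qed.

Lemma rational_spanP (q : rat) (x y : X) :
  rational_span x -> rational_span y -> rational_span ((ratr q : R) *: x + y).
Proof.
move=> [s _ <-] [t _ <-]; exists ([seq (q * c.1, c.2) | c <- s] ++ t) => //.
rewrite big_cat big_map scaler_sumr; congr (_ + _).
by apply: eq_bigr => c _; rewrite scalerA rmorphM.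
Qed.

Let closure_spanP x : closure rational_span x <->
  forall e, 0 < e -> exists2 y, rational_span y & `|x - y| < e.
Proof.
split=> [cx e e0|H U /nbhs_ballP[e /= e0 eU]].
  have [y [sy xy]] := cx _ (nbhsx_ballx x e e0).
  by exists y => //; move: xy; rewrite -ball_normE.
have [y sy xy] := H e e0.
by exists y; split => //; apply: eU; rewrite -ball_normE.
Qed.

Let closure_span0 : closure rational_span 0.
Proof. by apply: subset_closure; exists [::] => //; rewrite big_nil. Qed.

Let closure_span_linear (a : R) (x y : X) : closure rational_span x ->
  closure rational_span y -> closure rational_span (a *: x + y).
Proof.
move=> /closure_spanP cx /closure_spanP cy; apply/closure_spanP => e e0.
have a1 : 0 < `|a| + 1 by rewrite ltr_wpDl.
have e3 : 0 < e / 3 by rewrite divr_gt0.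
have [x' sx' xx'] := cx _ (divr_gt0 e3 a1).
have [y' sy' yy'] := cy _ e3.
have x1 : 0 < `|x'| + 1 by rewrite ltr_wpDl.
have ex1 := divr_gt0 e3 x1.
(* The rational [q] is so close to [a] that replacing [a] by it in front of [x'] costs at most
   [e / 3]; adding 1 to the norms keeps the denominators positive. *)
have [q] := rat_in_itvoo (ltr_pwDr ex1 (lexx a)).
rewrite in_itv/= => /andP[aq qa].
exists ((ratr q : R) *: x' + y'); first exact: rational_spanP.
have -> : a *: x + y - (ratr q *: x' + y') =
    a *: (x - x') + (a - ratr q) *: x' + (y - y').
  rewrite scalerBr scalerBl opprD addrACA; congr (_ + _).
  by rewrite addrA subrK.
rewrite (le_lt_trans (ler_normD _ _))//.
have := ler_normD (a *: (x - x')) ((a - ratr q) *: x'); rewrite !normrZ.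
have h1 : `|a| * `|x - x'| <= e / 3.
  move: xx'; rewrite ltr_pdivlMr// => xx'; apply: le_trans (ltW xx').
  by rewrite mulrC ler_wpM2l// lerDl.
have h2 : `|a - ratr q| * `|x'| <= e / 3.
  have aqe : `|a - ratr q| < e / 3 / (`|x'| + 1).
    by rewrite ltr0_norm ?subr_lt0//; lra.
  move: aqe; rewrite ltr_pdivlMr// => aqe; apply: le_trans (ltW aqe).
  by rewrite ler_wpM2l// lerDl.
by lra.
Qed.

Definition countable_span : closedSubspace X :=
  @ClosedSubspace _ _ (closure rational_span) closure_span0 closure_span_linear
    (@closed_closure _ _).

Lemma countable_span_mem i : (countable_span : set X) (v i).
Proof.
apply: subset_closure; exists [:: (1, i)] => //.
by rewrite big_seq1 /= rmorph1 scale1r.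
Qed.

(** The rational combinations form a countable set, dense in its own closure. *)
Lemma countable_span_separable : separable (subspace_type countable_span).
Proof.
exists [set y | rational_span (val y)].
  have /countable_injP[f finj] := rational_span_countable.
  apply/countable_injP; exists (f \o val) => y z /[!inE] sy sz /= fyz.
  by apply: val_inj; apply: finj; rewrite ?inE.
move=> O [y Oy] oO.
have /nbhs_ballP[e /= e0 eO] : nbhs y O by exact: open_nbhs_nbhs.
have /closure_spanP/(_ e e0)[d sd yd] : (countable_span : set X) (val y).
  exact: set_mem (valP y).
have cd : (countable_span : set X) d by exact: subset_closure.
exists (exist (subspace_pred countable_span) d (mem_set cd)); split => //.
by apply: eO; rewrite -ball_normE /ball_ /= subspace_normE raddfB.
Qed.

End CountableSpan.

(** * From separable subspaces to the whole space *)

Lemma representation_of_separable (R : realType) (X : completeNormedModType R) :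
  (forall Y : closedSubspace X, separable (subspace_type Y) ->
     graphon_representation_property (subspace_type Y)) ->
  graphon_representation_property X.
Proof.
move=> HY G bG cG.
(* All vertex pairs of all the graphs form a countable type, so the decorations span a separable
   subspace. *)
pose I := {n : nat & (tvertex (G n) * tvertex (G n))%type}.
pose v (i : I) : X := tdeco (t := G (tag i)) (tagged i).1 (tagged i).2.
pose Y := countable_span v.
have Yv n (a b : tvertex (G n)) : (Y : set X) (tdeco a b).
  exact: (@countable_span_mem _ _ _ v (existT _ n (a, b))).
pose dG n (a b : tvertex (G n)) : subspace_type Y :=
  exist (subspace_pred Y) (tdeco a b) (mem_set (Yv n a b)).
have dGC n (a b : tvertex (G n)) : dG n a b = dG n b a.
  by apply: val_inj => /=; exact: tdeco_sym.
pose G' n : targetGraph (subspace_type Y) := TargetGraph (tvertex_gt0 (G n)) (dGC n).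
have [||W bW WG] := HY Y (countable_span_separable v) G'.
- exact: bG.
(* A functional on [Y] is tested through an extension to [X], for which convergence is assumed;
   restriction is used below for the limit. *)
- move=> F; have := cG (map_test (@dual_extend _ _ Y) F).
  suff -> : (fun n => density (map_test (@dual_extend _ _ Y) F) (G n)) =
            (fun n => density F (G' n)) by [].
  by apply/funext => n; rewrite -density_dual_extend.
exists (val \o W); last first.
  by move=> F; exact: (WG (map_test (@dual_restrict _ _ Y) F)).
split.
- exact: strongly_measurable_comp (graphon_measurable bW) (@val_continuous _ _ Y).
- have [N [mN N0 NP]] := graphon_sym bW; exists N; split=> // z nz.
  by apply: NP => /= Wz; apply: nz; rewrite /= Wz.
- by move=> p p1; exact: (graphon_norm bW p1).
Qed.

Theorem theorem3p8 (R : realType) (X : completeNormedModType R) :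
  graphon_representation_property X <->
  (forall Y : closedSubspace X,
     separable (subspace_type Y) ->
     graphon_representation_property (subspace_type Y)).
Proof.
split=> [HX Y _|]; first exact: representation_subspace.
exact: representation_of_separable.
Qed.
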